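(* Assume that the block diagonal operator $\mathcal{L}$ is invertible on $X_{\nu,1}$. Let $\bar a\in X_{\nu,1}$, and let $Y$ and $Z=Z(r)$ (for $r>0$) be bounds satisfying $$\|\mathcal{T}(\bar a)-\bar a\|_{X_{\nu,1}}\le Y,\qquad \sup_{c\in \overline{B_r(\bar a)}}\|D_a\mathcal{T}(c)\|_{B(X_{\nu,1})}\le Z(r).$$ Define $p(r)=r(Z(r)-1)+Y$. If there exists $r_0>0$ such that $p(r_0)<0$, then there exists a unique $\hat a\in\overline{B_{r_0}(\bar a)}$ satisfying $F(\hat a)=0$.
   Context: Data: reals $\gamma_0,\gamma_2,\dots,\gamma_{2d}$ with $\lambda_k=\sum_{\ell=0}^d\gamma_{2\ell}(-1)^\ell k^{2\ell}$ for integers $k\ge0$, assumed to satisfy $\lambda_k\to-\infty$ as $k\to\infty$; a polynomial $Q(u)=\sum_{m=2}^p q_m u^m$ with real coefficients; a step size $h>0$; $\nu\ge1$; and an initial condition $b=(b_k)_{k\ge0}$ with $|b_0|+2\sum_{k\ge1}|b_k|\nu^k<\infty$. Set $\mu_k=-\frac h2\lambda_k$. Space: $X_{\nu,1}=\{a=(a_{k,j})_{k,j\ge0}: \|a\|_{X_{\nu,1}}=\sum_{k,j\ge0}|a_{k,j}|\omega_{k,j}<\infty\}$ (real sequences), with $\omega_{0,0}=1$, $\omega_{0,j}=2$ for $j>0$, $\omega_{k,0}=2\nu^k$ for $k>0$, $\omega_{k,j}=4\nu^k$ for $k,j>0$. It is a Banach algebra under the discrete convolution $(a*b)_{k,j}=\sum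 a_{|k_1|,|j_1|}b_{|k_2|,|j_2|}$, summed over all integers with $k_1+k_2=k$, $j_1+j_2=j$. $\|\cdot\|_{B(X_{\nu,1})}$ is the induced operator norm on bounded linear operators on $X_{\nu,1}$. Operators: $(\mathcal{L}a)_{k,0}=a_{k,0}+2\sum_{\ell\ge1}(-1)^\ell a_{k,\ell}$ and $(\mathcal{L}a)_{k,j}=\mu_k a_{k,j-1}+2j\,a_{k,j}-\mu_k a_{k,j+1}$ for $j\ge1$, $k\ge0$. $(\mathbf{\Lambda}a)_{k,0}=0$ and $(\mathbf{\Lambda}a)_{k,j}=-a_{k,j-1}+a_{k,j+1}$ for $j\ge1$. $\mathcal{Q}(a)=\sum_{m=2}^p q_m a^m$, where $a^m$ is the $m$-fold discrete convolution power. The sequence $b$ is identified with the element having entries $b_{k,0}=b_k$ and $b_{k,j}=0$ for $j>0$. The map $F$ is given componentwise by $F(a)=\mathcal{L}a-b+\frac h2\mathbf{\Lambda}\mathcal{Q}(a)$. ''$\mathcal{L}$ is invertible on $X_{\nu,1}$'' means: for every $y\in X_{\nu,1}$ there is a unique $a\in X_{\nu,1}$ with $\mathcal{L}a=y$, and $\mathcal{L}^{-1}:y\mapsto a$ is a bounded operator on $X_{\nu,1}$. Then $\mathcal{T}:X_{\nu,1}\to X_{\nu,1}$ is $\mathcal{T}(a)=\mathcal{L}^{-1}\left(b-\frac h2\mathbf{\Lambda}\mathcal{Q}(a)\right)$ (formally $a-\mathcal{L}^{-1}F(a)$); $D_a\mathcal{T}(c)$ is its Fréchet derivative at $c$. $\overline{B_r(\bar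 a)}=\{a\in X_{\nu,1}:\|a-\bar a\|_{X_{\nu,1}}\le r\}$. *)

(* Defs.v *)
From HB Require Import structures.
From mathcomp Require Import all_boot all_order all_algebra.
From mathcomp Require Import all_classical all_reals all_analysis.

Set Implicit Arguments.
Unset Strict Implicit.
Unset Printing Implicit Defensive.
Import Order.TTheory GRing.Theory Num.Theory.
Import numFieldNormedType.Exports.

Local Open Scope classical_set_scope.
Local Open Scope ring_scope.

Definition omega (R : realType) (nu : R) (k j : nat) : R :=
  match k, j with
  | 0%N, 0%N => 1
  | 0%N, _ => 2
  | _, 0%N => 2 * nu ^+ k
  | _, _ => 4 * nu ^+ k
  end.

Definition wnorm (R : realType) (nu : R) (a : nat -> nat -> R) : \bar R :=
  \esum_(x in [set: nat * nat]) (`|a x.1 x.2| * omega nu x.1 x.2)%:E.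

(* [nu_ge1] is not used below, but the normed-space instance needs positive
   weights and finds the proof in the type. *)
Definition summable2 (R : realType) (nu : R) (nu_ge1 : 1 <= nu) :
    {pred (nat -> nat -> R)} :=
  [pred a | (wnorm nu a < +oo)%E].

Record Xspace (R : realType) (nu : R) (nu_ge1 : 1 <= nu) := MkX {
  seqX :> nat -> nat -> R ;
  seqX_summable : seqX \in summable2 nu_ge1 }.

Section space.
Variables (R : realType) (nu : R) (nu_ge1 : 1 <= nu).
Implicit Types (a b : nat -> nat -> R) (l : R).

Let nu_gt0 : 0 < nu. Proof. exact: lt_le_trans nu_ge1. Qed.

Lemma omega_gt0 k j : 0 < omega nu k j.
Proof. by case: k => [|k]; case: j => [|j] //=; rewrite mulr_gt0 ?exprn_gt0. Qed.

Let term_ge0 a x : (0%:E <= (`|a x.1 x.2| * omega nu x.1 x.2)%:E)%E.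
Proof. by rewrite lee_fin mulr_ge0// ltW// omega_gt0. Qed.

Lemma wnorm_ge0 a : (0 <= wnorm nu a)%E.
Proof. by apply: esum_ge0 => x _; exact: term_ge0. Qed.

Lemma wnorm_ge_coef a k j : ((`|a k j| * omega nu k j)%:E <= wnorm nu a)%E.
Proof.
apply: esum_ge; exists [set (k, j)]; first by split.
by rewrite fsbig_set1.
Qed.

Lemma wnorm0 : wnorm nu (0 : nat -> nat -> R) = 0%E.
Proof. by apply: esum1 => x _; rewrite normr0 mul0r. Qed.

Lemma wnormD a b : (wnorm nu (a + b)%R <= wnorm nu a + wnorm nu b)%E.
Proof.
rewrite /wnorm -esumD => [|x _|x _]; try exact: term_ge0.
apply: le_esum => x _; rewrite -EFinD lee_fin -mulrDl.
by rewrite ler_wpM2r ?ler_normD// ltW// omega_gt0.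
Qed.

Lemma wnormZ_le l a : (wnorm nu (l *: a)%R <= `|l|%:E * wnorm nu a)%E.
Proof.
apply: ge_ereal_sup => _ [A [finA _] <-].
rewrite (_ : \sum_(x \in A) _ = `|l|%:E *
    \sum_(x \in A) (`|a x.1 x.2| * omega nu x.1 x.2)%:E)%E.
  rewrite lee_wpmul2l ?lee_fin//.
  by apply: ereal_sup_ubound; exists A.
rewrite !fsbig_finite//= !sumEFin -EFinM; congr EFin; rewrite mulr_sumr.
by apply: eq_bigr => x _; rewrite [(l *: a) _ _]/(l * _) normrM mulrA.
Qed.

Lemma summable2_submod : submod_closed (summable2 nu_ge1).
Proof.
split; first by rewrite inE/= wnorm0 ltry.
move=> l a b; rewrite !inE /= => ha hb.
apply: le_lt_trans (wnormD _ _) _; rewrite lte_add_pinfty//.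
by apply: le_lt_trans (wnormZ_le _ _) _; rewrite lte_mul_pinfty.
Qed.

HB.instance Definition _ := GRing.isSubmodClosed.Build R (nat -> nat -> R)
  (summable2 nu_ge1) summable2_submod.

HB.instance Definition _ := [isSub for @seqX R nu nu_ge1].
HB.instance Definition _ := [Choice of Xspace nu_ge1 by <:].
HB.instance Definition _ := [SubChoice_isSubLmodule of Xspace nu_ge1 by <:].

Implicit Types x y : Xspace nu_ge1.

Lemma seqXD x y : seqX (x + y) = (seqX x + seqX y)%R.
Proof. by []. Qed.

Lemma seqXZ l x : seqX (l *: x) = l *: seqX x.
Proof. by []. Qed.

Definition normX x : R := fine (wnorm nu x).

Lemma normXE x : (normX x)%:E = wnorm nu x.
Proof.
by rewrite fineK// ge0_fin_numE ?wnorm_ge0//; have := seqX_summable x; rewrite inE.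
Qed.

Lemma normX_ge0 x : 0 <= normX x.
Proof. by rewrite -lee_fin normXE wnorm_ge0. Qed.

Lemma normXD x y : normX (x + y) <= normX x + normX y.
Proof. by rewrite -lee_fin EFinD !normXE seqXD; exact: wnormD. Qed.

Let normXZ_le l x : normX (l *: x) <= `|l| * normX x.
Proof. by rewrite -lee_fin EFinM !normXE seqXZ; exact: wnormZ_le. Qed.

Lemma normXZ l x : normX (l *: x) = `|l| * normX x.
Proof.
apply/eqP; rewrite eq_le normXZ_le /=.
have [->|l0] := eqVneq l 0; first by rewrite normr0 mul0r normX_ge0.
rewrite -ler_pdivlMl ?normr_gt0// -normfV.
by rewrite -{1}[x](scalerK l0) normXZ_le.
Qed.

Lemma normX_eq0 x : normX x = 0 -> x = 0.
Proof.
move=> x0; apply: val_inj; apply/funext => k; apply/funext => j.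
have := wnorm_ge_coef x k j; rewrite -normXE x0 lee_fin.
rewrite pmulr_lle0 ?omega_gt0// normr_le0 => /eqP; exact.
Qed.

HB.instance Definition _ := @Lmodule_isNormed.Build R (Xspace nu_ge1)
  normX normXD normXZ normX_eq0.

End space.

(* The sum of an absolutely summable real family, as the difference of the
   sums of its positive and negative parts. *)
Definition usum (R : realType) (T : choiceType) (f : T -> R) : R :=
  fine (\esum_(x in [set: T]) (Num.max (f x) 0)%:E) -
  fine (\esum_(x in [set: T]) (Num.max (- f x) 0)%:E).

Section operators.
Variable R : realType.
Implicit Types (a c : nat -> nat -> R) (mu b q : nat -> R) (h : R).

(* [k1 + k2 = k] and [j1 + j2 = j] are solved for [k2] and [j2]. *)
Definition conv a c : nat -> nat -> R := fun k j =>
  usum (fun n : int * int =>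
    a `|n.1|%N `|n.2|%N * c `|k%:Z - n.1|%N `|j%:Z - n.2|%N).

Definition conv1 : nat -> nat -> R := fun k j => ((k == 0%N) && (j == 0%N))%:R.

Definition conv_exp a (m : nat) : nat -> nat -> R := iterop m conv a conv1.

Definition Qop (p : nat) q a : nat -> nat -> R :=
  \sum_(2 <= m < p.+1) q m *: conv_exp a m.

Definition Lop mu a : nat -> nat -> R := fun k j =>
  match j with
  | 0%N => a k 0 + 2 * (\big[+%R/0]_(1 <= l <oo) ((-1) ^+ l * a k l))
  | j'.+1 => mu k * a k j' + 2 * j%:R * a k j - mu k * a k j.+1
  end.

Definition Lamop a : nat -> nat -> R := fun k j =>
  match j with
  | 0%N => 0
  | j'.+1 => - a k j' + a k j.+1
  end.

Definition embed b : nat -> nat -> R := fun k j => if j == 0%N then b k else 0.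

(* [g] is indexed as in the paper: only its even indices up to [2 * d] occur. *)
Definition lambda (d : nat) (g : nat -> R) (k : nat) : R :=
  \sum_(0 <= l < d.+1) g l.*2 * (-1) ^+ l * k%:R ^+ l.*2.

Definition Fop h mu b p q a : nat -> nat -> R :=
  Lop mu a - embed b + (h / 2) *: Lamop (Qop p q a).

End operators.

Section invertibility.
Variables (R : realType) (nu : R) (nu_ge1 : 1 <= nu).
Local Notation X := (Xspace nu_ge1).
Implicit Types (mu b q : nat -> R) (h : R).

(* [Lop mu] need not map [X] into itself, so its inverse is defined on all
   double sequences; only its values on [X] are meaningful. *)
Definition Linv mu (y : nat -> nat -> R) : X :=
  xget 0 [set a : X | Lop mu a = y].

Definition L_invertible mu : Prop :=
  (forall y : X, exists! a : X, Lop mu a = y) /\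
  (exists C : R, forall y : X, `|Linv mu y| <= C * `|y|).

(* The argument of [Linv] below belongs to [X] as soon as [b] is summable,
   [X] being stable under [conv] and [Lamop]. *)
Definition Top h mu b p q (a : X) : X :=
  Linv mu (embed b - (h / 2) *: Lamop (Qop p q a)).

End invertibility.

Definition opnorm (R : realType) (V : normedModType R) (f : V -> V) : \bar R :=
  ereal_sup [set `|f v|%:E | v in [set v : V | `|v| <= 1]].

(* Main.v *)
Require Import Defs.
From HB Require Import structures.
From mathcomp Require Import all_boot all_order all_algebra.
From mathcomp Require Import all_classical all_reals all_analysis.
From mathcomp Require Import ring lra zify.
Set Implicit Arguments.
Unset Strict Implicit.
Unset Printing Implicit Defensive.
Import Order.TTheory GRing.Theory Num.Theory.
Import numFieldNormedType.Exports.
Local Open Scope classical_set_scope.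
Local Open Scope ring_scope.

(** Since [L] is invertible, [F a = 0] says exactly that [a] is a fixed point
of [T], so the theorem is the contraction mapping principle for [T] on the
closed ball of radius [r0] around [abar]. The negativity of the radii
polynomial gives both hypotheses of that principle. First,
[0 <= Z r0 < 1] because [Y >= 0]. Second, [T] maps the ball into itself:
by the mean value inequality [T] is [Z r0]-Lipschitz on the ball, hence
[|T x - abar| <= Z r0 * r0 + Y < r0]
([radii_polynomial_fixpoint]).

Three facts about the weighted space support this argument.

- It is complete ([Xspace_complete]): a Cauchy filter converges coefficientwise,
  and the norm of a coefficientwise limit is bounded by a Fatou argument.

- Discrete convolution is a bounded bilinear map ([wnorm_conv_le]): it is the
  usual convolution over the group of integer pairs of the even extensions, the
  weight [nu ^ |k|] is submultiplicative on that group, and Tonelli's theorem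
  for unordered sums applies.

- Hence the powers are differentiable by the product rule, and [T], the
  composite of these powers with the bounded linear maps [Lamop] and the inverse
  of [L], is Frechet differentiable everywhere ([differentiable_Top]). This
  matters twice: the differential in the hypothesis is then the genuine one,
  rather than a default value, and the mean value inequality becomes available.

A vector-valued map need not attain its increments by its derivative, so the
mean value inequality is not deduced from a mean value equality: local Lipschitz
bounds are propagated along the segment by a supremum argument
([ler_norm_increment]). *)

(** * The mean value inequality and the radii polynomial argument *)

Section mean_value.
Context {R : realType} {V W : normedModType R}.

(** The points [t] at which the increment from [0] is at most [M * t] have a
supremum. It is one of these points by the local bound on its left, and the
local bound on its right would produce a larger one if it were below [1]. *)
Lemma ler_norm_increment (g : R -> W) (M : R) :
  (forall c : R, 0 <= c <= 1 -> \forall t \near c, `|g t - g c| <= M * `|t - c|) ->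
  `|g 1 - g 0| <= M.
Proof.
move=> loc.
pose S := [set t | 0 <= t <= 1 /\ `|g t - g 0| <= M * t].
have S0 : S 0 by split; rewrite ?lexx ?ler01 ?subrr ?normr0 ?mulr0.
have supS : has_sup S by split; [exists 0| exists 1 => t [/andP[]]].
pose s := sup S.
have s01 : 0 <= s <= 1.
  rewrite sup_upper_bound//=; apply: ge_sup; first by exists 0.
  by move=> t [/andP[]].
have /nbhs_ballP[e /= e0 He] := loc s s01.
have Ss : S s.
  split=> //; have [t [t01 gt0] st] := sup_adherent e0 supS.
  have ts : t <= s by exact: sup_upper_bound.
  have : ball s e t by rewrite /ball/= ger0_norm; [rewrite /s; lra|lra].
  move=> /He; rewrite distrC (distrC t) (ger0_norm (_ : 0 <= s - t)); last lra.
  move=> gst; rewrite -(subrKA (g t)) (le_trans (ler_normD _ _))//.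
  by rewrite (le_trans (lerD gst gt0))// -mulrDr subrK.
have [s1|s1] := ltP s 1; last first.
  by case: Ss => _; rewrite (_ : s = 1) ?mulr1//; lra.
(* A point of the segment beyond [s] that stays within the radius [e]. *)
pose t := Num.min 1 (s + e / 2).
have t1 : t <= 1 by rewrite ge_min lexx.
have ste : t <= s + e / 2 by rewrite ge_min lexx orbT.
have st : s < t by rewrite lt_min s1/= ltrDl; lra.
have : S t.
  split; first lra.
  have : ball s e t by rewrite /ball/= ltr0_norm; lra.
  move=> /He; rewrite (ger0_norm (_ : 0 <= t - s)); last lra.
  move=> gts; rewrite -(subrKA (g s)) (le_trans (ler_normD _ _))//.
  by case: Ss => _ gs0; rewrite (le_trans (lerD gts gs0))// -mulrDr subrK.
by move=> /(sup_upper_bound supS); rewrite -/s leNgt st.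
Qed.

Lemma differentiable_near_lipschitz (f : V -> W) (x : V) (K e : R) :
  differentiable f x -> (forall v, `|'d f x v| <= K * `|v|) -> 0 < e ->
  \forall v \near (0 : V), `|f (x + v) - f x| <= (K + e) * `|v|.
Proof.
move=> df dK e0.
have /eqaddoP/(_ _ e0) := funext (diff_locallyxC df).
apply: filter_app; near=> v => /= fv.
rewrite -(subrK ('d f x v) (f (x + v) - f x)) (le_trans (ler_normD _ _))//.
rewrite mulrDl addrC lerD//; apply: le_trans fv.
by rewrite -[leRHS]/(`|f (x + v) - (f x + 'd f x v)|) opprD addrA.
Unshelve. all: by end_near. Qed.

(** Differentiability makes [f] locally [(K + e)]-Lipschitz at each point of the
segment, for every [e > 0], and this local bound propagates along the
segment. *)
Lemma mean_value_inequality (f : V -> W) (x y : V) (K : R) :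
  (forall t : R, 0 <= t <= 1 -> differentiable f (x + t *: (y - x))) ->
  (forall t : R, 0 <= t <= 1 -> forall v,
     `|'d f (x + t *: (y - x)) v| <= K * `|v|) ->
  `|f y - f x| <= K * `|y - x|.
Proof.
move=> df dK.
suff H e : 0 < e -> `|f y - f x| <= (K + e) * `|y - x|.
  have [->|yx] := eqVneq y x; first by rewrite !subrr !normr0 mulr0.
  have yx0 : 0 < `|y - x| by rewrite normr_gt0 subr_eq0.
  apply/ler_addgt0Pr => e e0; have := H (e / `|y - x|) (divr_gt0 e0 yx0).
  by rewrite mulrDl divfK ?gt_eqF.
move=> e0; pose g t := f (x + t *: (y - x)).
have -> : f y - f x = g 1 - g 0 by rewrite /g scale1r scale0r addr0 subrKC.
apply: ler_norm_increment => c c01.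
have := differentiable_near_lipschitz (df c c01) (dK c c01) e0.
have cv : (fun t => (t - c) *: (y - x)) @ c --> (0 : V).
  rewrite -(scale0r (y - x)); apply: (@cvgZr_tmp _ _ _ (nbhs c)).
  by rewrite -(subrr c); apply: (@cvgB _ _ _ (nbhs c)); [exact: cvg_id|exact: cvg_cst].
move=> fc; near=> t.
have -> : g t - g c =
    f (x + c *: (y - x) + (t - c) *: (y - x)) - f (x + c *: (y - x)).
  by rewrite /g -addrA -scalerDl subrKC.
rewrite -mulrA (mulrC `|y - x|) -normrZ; near: t; exact: cv _ fc.
Unshelve. all: by end_near. Qed.

End mean_value.

Lemma ler_opnorm {R : realType} {V : normedModType R} (f : {linear V -> V})
    (K : R) : (opnorm f <= K%:E)%E -> forall v, `|f v| <= K * `|v|.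
Proof.
move=> fK v; have [->|v0] := eqVneq v 0; first by rewrite linear0 !normr0 mulr0.
have nv : 0 < `|v| by rewrite normr_gt0.
rewrite -ler_pdivrMr// mulrC -(ger0_norm (_ : 0 <= `|v|^-1))//.
rewrite -normrZ -linearZ -lee_fin; apply: le_trans fK.
apply: ereal_sup_ubound; exists (`|v|^-1 *: v) => //=.
by rewrite normrZ normfV normr_id mulVf// gt_eqF.
Qed.

Section newton_kantorovich.
Context {R : realType} {V : completeNormedModType R}.

(** The Newton-Kantorovich theorem in radii polynomial form. As [Y] is
nonnegative, [r * (Z - 1) + Y < 0] forces [Z < 1], and it bounds the distance
of [T x] to [x0] by [Z * r + Y < r] for all [x] in the ball. *)
Lemma radii_polynomial_fixpoint (T : V -> V) (x0 : V) (Y Z r : R) :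
  (forall c, `|c - x0| <= r -> differentiable T c) ->
  (forall c, `|c - x0| <= r -> (opnorm ('d T c) <= Z%:E)%E) ->
  `|T x0 - x0| <= Y -> 0 < r -> r * (Z - 1) + Y < 0 ->
  exists! x, `|x - x0| <= r /\ T x = x.
Proof.
move=> dT TZ TY r0 p0.
have Y0 : 0 <= Y := le_trans (normr_ge0 _) TY.
have x0B : `|x0 - x0| <= r by rewrite subrr normr0 ltW.
have Z0 : 0 <= Z.
  rewrite -lee_fin; apply: le_trans (TZ _ x0B); apply: ereal_sup_ubound.
  by exists 0 => /=; rewrite ?linear0 normr0.
have Z1 : Z < 1 by nra.
pose B := [set x : V | `|x - x0| <= r].
have lipT x y : B x -> B y -> `|T y - T x| <= Z * `|y - x|.
  move=> Bx By.
  have Bt t : 0 <= t <= 1 -> B (x + t *: (y - x)).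
    move=> /andP[t0 t1]; rewrite /B/=.
    have -> : x + t *: (y - x) - x0 = (1 - t) *: (x - x0) + t *: (y - x0).
      rewrite scalerBl scale1r addrAC -[RHS]addrA; congr (_ + _).
      by rewrite addrC -scalerBr opprB subrKA.
    rewrite (le_trans (ler_normD _ _))// !normrZ !ger0_norm ?subr_ge0//.
    by move: Bx By; rewrite /B/=; nra.
  apply: mean_value_inequality => t t01; first exact/dT/Bt.
  exact: ler_opnorm (TZ _ (Bt _ t01)).
have TB : set_fun B B T.
  move=> x Bx; rewrite /B/= -(subrKA (T x0)) (le_trans (ler_normD _ _))//.
  have := lipT _ _ x0B Bx; move: Bx; rewrite /B/=; nra.
pose q : {nonneg R} := NngNum Z0.
pose TF : {fun B >-> B} := HB.pack T (isFun.Build _ _ _ _ T TB).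
have ctrT : is_contraction TF.
  exists q; split=> // -[x y] [/= Bx By]; exact: lipT.
have clB : closed B.
  have -> : B = closed_ball x0 r.
    rewrite closed_ballE//; apply/seteqP; split => x /=;
      by rewrite /B/= /closed_ball_ /= distrC.
  exact: closed_ball_closed.
have [x Bx Tx] := banach_fixed_point ctrT clB (ex_intro _ x0 x0B).
exists x; split=> [|y [By Ty]]; first by split.
exact: contraction_fixpoint_unique ctrT Bx By Tx (esym Ty).
Qed.

End newton_kantorovich.

(** * Differentiability of bounded linear and bilinear maps *)

Section bounded_maps.
Context {R : realType} {U V W : normedModType R}.

Lemma bounded_linear_differentiable (f : {linear U -> V}) (C : R) (x : U) :
  (forall u, `|f u| <= C * `|u|) -> differentiable f x.
Proof.
move=> fC; apply: linear_differentiable; apply: bounded_linear_continuous.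
apply/linear_boundedP; near=> r => u.
rewrite (le_trans (fC u))// ler_wpM2r//.
Unshelve. all: by end_near. Qed.

(** Continuity, from which differentiability follows, comes from writing
[B u v - B u0 v0] as [B (u - u0) v + B u0 (v - v0)]. *)
Lemma bounded_bilinear_differentiable (B : {bilinear U -> V -> W}) (C : R) p :
  (forall u v, `|B u v| <= C * (`|u| * `|v|)) ->
  differentiable (fun z : U * V => B z.1 z.2) p.
Proof.
move=> BC; apply: differentiable_bilin => {p} -[u0 v0].
pose phi (z : U * V) := C * (`|z.1 - u0| * `|z.2|) + C * (`|u0| * `|z.2 - v0|).
have phi0 : phi z @[z --> (u0, v0)] --> (0 : R).
  have -> : 0 = phi (u0, v0) by rewrite /phi/= !subrr !normr0 mul0r !mulr0 addr0.
  apply: cvgD; apply: cvgMr; apply: cvgM.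
  - by apply: cvg_norm; apply: cvgB; [exact: cvg_fst|exact: cvg_cst].
  - by apply: cvg_norm; exact: cvg_snd.
  - exact: cvg_cst.
  - by apply: cvg_norm; apply: cvgB; [exact: cvg_snd|exact: cvg_cst].
apply/cvgrPdist_le => e e0.
move/cvgrPdist_le : phi0 => /(_ e e0); apply: filterS => -[u v] /=.
rewrite sub0r normrN => /(le_trans (ler_norm _)); apply: le_trans.
have -> : B u0 v0 - B u v = - (B (u - u0) v + B u0 (v - v0)).
  by rewrite linearBl linearBr subrKA opprB.
by rewrite normrN (le_trans (ler_normD _ _))// lerD.
Qed.

End bounded_maps.

(** * Unordered sums *)

Section esum_extra.
Context {R : realType}.
Local Open Scope ereal_scope.

Lemma esum_inj_le {T U : choiceType} (D : set T) (phi : T -> U)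
    (f : U -> \bar R) :
  (forall u, 0 <= f u) -> set_inj D phi ->
  \esum_(x in D) f (phi x) <= \esum_(u in [set: U]) f u.
Proof.
move=> f0 phiI; rewrite -esum_image// esum_mkcond; apply: le_esum => u _.
by case: ifP.
Qed.

Lemma esumZl {T : choiceType} (D : set T) (r : R) (f : T -> \bar R) :
  (0 <= r)%R -> (forall x, 0 <= f x) ->
  \esum_(x in D) (r%:E * f x) = r%:E * \esum_(x in D) f x.
Proof.
have le s (g : T -> \bar R) : (0 <= s)%R -> (forall x, 0 <= g x) ->
    \esum_(x in D) (s%:E * g x) <= s%:E * \esum_(x in D) g x.
  move=> s0 g0; apply: ge_ereal_sup => _ [A [finA AD] <-].
  rewrite -ge0_mule_fsumr//; apply: lee_wpmul2l => //.
  by apply: ereal_sup_ubound; exists A.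
rewrite le_eqVlt => /predU1P[<-|r0] f0.
  by rewrite mul0e esum1// => x _; rewrite mul0e.
apply/eqP; rewrite eq_le le ?(ltW r0)//= -lee_pdivlMl//.
(* The converse inequality is the first one applied to [r^-1] and [r * f]. *)
rewrite [X in X <= _](_ : _ = \esum_(x in D) (r^-1%:E * (r%:E * f x))).
  by apply: le; rewrite ?invr_ge0 ?(ltW r0)// => x; rewrite mule_ge0// lee_fin ltW.
by apply: eq_esum => x _; rewrite muleA -EFinM mulVf ?gt_eqF// mul1e.
Qed.

(** Tonelli's theorem for unordered sums. *)
Lemma esum_swap {T U : choiceType} (f : T -> U -> \bar R) :
  (forall x y, 0 <= f x y) ->
  \esum_(x in [set: T]) \esum_(y in [set: U]) f x y =
  \esum_(y in [set: U]) \esum_(x in [set: T]) f x y.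
Proof.
move=> f0; rewrite !esum_esum//.
apply: (reindex_esum _ _ (fun z : U * T => (z.2, z.1))).
split => [[]|[x y] [x' y'] _ _ [-> ->]//|[x y] _] //.
by exists (y, x).
Qed.

End esum_extra.

Section unordered_sum.
Context {R : realType} {T : choiceType}.
Implicit Types f g : T -> R.

Definition abssum f : \bar R := \esum_(x in [set: T]) (`|f x|)%:E.

Let finite_esum f : (forall x, 0 <= f x) ->
  (abssum f < +oo)%E -> \esum_(x in [set: T]) (f x)%:E \is a fin_num.
Proof.
move=> f0; rewrite ge0_fin_numE ?esum_ge0// => [|x _]; last by rewrite lee_fin.
apply: le_lt_trans; apply: le_esum => x _; by rewrite lee_fin ler_norm.
Qed.

Lemma abssum_dominated f g :
  (forall x, `|f x| <= `|g x|) -> (abssum g < +oo)%E -> (abssum f < +oo)%E.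
Proof. by move=> fg; apply: le_lt_trans; apply: le_esum => x _; rewrite lee_fin. Qed.

Lemma abssumD_lty f g : (abssum f < +oo)%E -> (abssum g < +oo)%E ->
  (abssum (fun x => f x + g x)%R < +oo)%E.
Proof.
move=> fy gy; apply: le_lt_trans (lte_add_pinfty fy gy).
by rewrite -esumD//; apply: le_esum => x _; rewrite -EFinD lee_fin ler_normD.
Qed.

Lemma abssumZ_lty r f : (abssum f < +oo)%E ->
  (abssum (fun x => r * f x)%R < +oo)%E.
Proof.
move=> fy; rewrite /abssum (eq_esum (b := fun x => (`|r|%:E * `|f x|%:E)%E)).
  by rewrite esumZl// lte_mul_pinfty.
by move=> x _; rewrite normrM EFinM.
Qed.

(** The positive and negative parts in the definition of [usum] may be replaced by
any nonnegative summable decomposition; linearity of [usum] rests on this. *)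
Lemma usumB f g : (forall x, 0 <= f x) -> (forall x, 0 <= g x) ->
  (abssum f < +oo)%E -> (abssum g < +oo)%E ->
  usum (fun x => f x - g x) = fine (\esum_(x in [set: T]) (f x)%:E)
                              - fine (\esum_(x in [set: T]) (g x)%:E).
Proof.
move=> f0 g0 fy gy.
have fgy : (abssum (fun x => f x - g x)%R < +oo)%E.
  apply: (abssumD_lty fy); rewrite (_ : abssum _ = abssum g)//.
  by apply: eq_esum => x _; rewrite normrN.
have := @esumB R T [set: T] (EFin \o f) (EFin \o g) fy gy
  (fun x _ => f0 x) (fun x _ => g0 x).
rewrite (eq_esum (b := fun x => (Num.max (f x - g x) 0)%:E)); last first.
  by move=> x _; rewrite funeposE EFin_max.
rewrite [X in (_ - X)%E = _](eq_esum
  (b := fun x => (Num.max (- (f x - g x)) 0)%:E)); last first.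
  by move=> x _; rewrite funenegE EFin_max.
move=> eq.
have := congr1 fine eq; rewrite !fineB ?finite_esum//.
- by move=> x; rewrite le_max lexx orbT.
- apply: abssum_dominated fgy => x; rewrite ger0_norm ?le_max ?lexx ?orbT//.
  by rewrite ge_max ler_norm normr_ge0.
- by move=> x; rewrite le_max lexx orbT.
- apply: abssum_dominated fgy => x; rewrite ger0_norm ?le_max ?lexx ?orbT//.
  by rewrite ge_max -normrN ler_norm normr_ge0.
Qed.

Lemma usumD f g : (abssum f < +oo)%E -> (abssum g < +oo)%E ->
  usum (fun x => f x + g x) = usum f + usum g.
Proof.
move=> fy gy.
pose p (h : T -> R) x := Num.max (h x) 0.
have p0 h x : 0 <= p h x by rewrite le_max lexx orbT.
have pE h x : h x = p h x - p (fun y => - h y) x.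
  by rewrite /p; case: (leP (h x) 0); case: (leP (- h x) 0); lra.
have py h : (abssum h < +oo)%E -> (abssum (p h) < +oo)%E.
  apply: abssum_dominated => x; rewrite ger0_norm//.
  by rewrite ge_max ler_norm normr_ge0.
have Ny h : (abssum h < +oo)%E -> (abssum (fun x => - h x)%R < +oo)%E.
  by apply: abssum_dominated => x; rewrite normrN.
have -> : (fun x => f x + g x) = (fun x => (p f x + p g x) -
   (p (fun y => - f y) x + p (fun y => - g y) x)).
  by apply/funext => x; rewrite {1}(pE f) {1}(pE g); lra.
have sD h h' : (abssum h < +oo)%E -> (abssum h' < +oo)%E ->
   fine (\esum_(x in [set: T]) (p h x + p h' x)%:E) =
   fine (\esum_(x in [set: T]) (p h x)%:E) + fine (\esum_(x in [set: T]) (p h' x)%:E).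
  move=> hy h'y; have hf := finite_esum (p0 h) (py _ hy).
  have h'f := finite_esum (p0 h') (py _ h'y).
  by rewrite -(fineD hf h'f) -esumD// => x _; rewrite lee_fin.
have D h h' x : 0 <= p h x + p h' x by rewrite addr_ge0.
have fNy := Ny _ fy; have gNy := Ny _ gy.
rewrite (usumB (D _ _) (D _ _) (abssumD_lty (py _ fy) (py _ gy))
  (abssumD_lty (py _ fNy) (py _ gNy))) (sD _ _ fy gy) (sD _ _ fNy gNy).
rewrite /usum /p; lra.
Qed.

Lemma usumZ r f : (abssum f < +oo)%E ->
  usum (fun x => r * f x) = r * usum f.
Proof.
move=> fy.
have pos (s : R) (h : T -> R) : 0 <= s ->
    fine (\esum_(x in [set: T]) (Num.max (s * h x) 0)%:E) =
    s * fine (\esum_(x in [set: T]) (Num.max (h x) 0)%:E).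
  move=> s0; rewrite (eq_esum (b := fun x => (s%:E * (Num.max (h x) 0)%:E)%E)).
    rewrite (esumZl _ s0) => [|x]; last by rewrite lee_fin le_max lexx orbT.
    have [->|s1] := eqVneq s 0; first by rewrite mul0e mul0r.
    case: (\esum_(x in _) _)%E => [t//||]/=; rewrite ?mulr0.
    - by rewrite gt0_muley// lte_fin lt_neqAle eq_sym s1.
    - by rewrite gt0_muleNy// lte_fin lt_neqAle eq_sym s1.
  by move=> x _; rewrite -EFinM maxr_pMr// mulr0.
rewrite /usum; have [r0|r0] := leP 0 r.
  rewrite pos// mulrBr; congr (_ - _); rewrite -pos//.
  by congr fine; apply: eq_esum => x _; rewrite mulrN.
(* A negative factor exchanges the positive and negative parts. *)
have -> : \esum_(x in [set: T]) (Num.max (r * f x) 0)%:E =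
  \esum_(x in [set: T]) (Num.max ((- r) * (- f x)) 0)%:E.
  by apply: eq_esum => x _; rewrite mulrNN.
have -> : \esum_(x in [set: T]) (Num.max (- (r * f x)) 0)%:E =
  \esum_(x in [set: T]) (Num.max ((- r) * f x) 0)%:E.
  by apply: eq_esum => x _; rewrite mulNr.
have nr0 : 0 <= - r by rewrite oppr_ge0 ltW.
by rewrite (pos _ (fun x => - f x) nr0) (pos _ f nr0) !mulNr opprK mulrBr addrC.
Qed.

(** [fine] sends an infinite positive or negative part to [0], but then [abssum f]
is infinite and the bound is trivial. *)
Lemma normr_usum_le f : (`|usum f|%:E <= abssum f)%E.
Proof.
have -> : abssum f = (\esum_(x in [set: T]) (Num.max (f x) 0)%:E +
                     \esum_(x in [set: T]) (Num.max (- f x) 0)%:E)%E.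
  rewrite -esumD => [|x _|x _]; try by rewrite lee_fin le_max lexx orbT.
  apply: eq_esum => x _; rewrite -EFinD; congr EFin.
  by case: (leP (f x) 0); case: (leP (- f x) 0); case: (ler0P (f x)); lra.
rewrite /usum.
have : (0 <= \esum_(x in [set: T]) (Num.max (f x) 0)%:E)%E.
  by apply: esum_ge0 => x _; rewrite lee_fin le_max lexx orbT.
have : (0 <= \esum_(x in [set: T]) (Num.max (- f x) 0)%:E)%E.
  by apply: esum_ge0 => x _; rewrite lee_fin le_max lexx orbT.
case: (\esum_(x in _) (Num.max (- f x) 0)%:E)%E => [s| |]//;
  case: (\esum_(x in _) _)%E => [t| |]//; rewrite ?leey// !lee_fin/=.
by case: (ler0P (t - s)); lra.
Qed.

End unordered_sum.

(** * Norm estimates on double sequences *)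

Section weighted_l1.
Context {R : realType} {nu : R} (nu_ge1 : 1 <= nu).
Implicit Types a c : nat -> nat -> R.

Let nu_ge0 : 0 <= nu. Proof. exact: le_trans ler01 nu_ge1. Qed.

Let term_ge0 a x : (0%:E <= (`|a x.1 x.2| * omega nu x.1 x.2)%:E)%E.
Proof. by rewrite lee_fin mulr_ge0// ltW// omega_gt0. Qed.

Lemma omega_ge_expr k j : nu ^+ k <= omega nu k j.
Proof.
have := exprn_ge0 k nu_ge0.
by case: k => [|k]; case: j => [|j] /=; rewrite ?expr0//; lra.
Qed.

Lemma omega_le_expr k j : omega nu k j <= 4 * nu ^+ k.
Proof.
have := exprn_ge0 k nu_ge0.
by case: k => [|k]; case: j => [|j] /=; rewrite ?expr0//; lra.
Qed.

Lemma ler_coef_wnorm a k j : (`|a k j|%:E <= wnorm nu a)%E.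
Proof.
apply: le_trans _ (wnorm_ge_coef nu a k j); rewrite lee_fin ler_peMr//.
by rewrite (le_trans _ (omega_ge_expr k j))// exprn_ege1.
Qed.

(** With this extension [conv] is the convolution of the group of integer pairs. *)
Definition even_ext a (n : int * int) : R := a `|n.1|%N `|n.2|%N.

Definition zweight (n : int * int) : R := nu ^+ `|n.1|%N.

Definition znorm a : \bar R :=
  \esum_(n in [set: int * int]) (`|even_ext a n| * zweight n)%:E.

Lemma zweight_ge0 n : 0 <= zweight n.
Proof. by rewrite exprn_ge0. Qed.

Lemma zweight_submul m n : zweight (m + n) <= zweight m * zweight n.
Proof.
rewrite -exprD ler_weXn2l//=; case: m n => [m1 m2] [n1 n2] /=; lia.
Qed.

Lemma znorm_ge0 a : (0 <= znorm a)%E.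
Proof. by apply: esum_ge0 => n _; rewrite lee_fin mulr_ge0 ?zweight_ge0. Qed.

(** Each pair of natural numbers is the absolute value of at most four pairs of
integers, one for each choice of signs. *)
Lemma znorm_le a : (znorm a <= 4%:E * wnorm nu a)%E.
Proof.
pose phi (n : int * int) : (bool * bool) * (nat * nat) :=
  ((n.1 < 0, n.2 < 0), (`|n.1|%N, `|n.2|%N)).
have phiI : set_inj [set: int * int] phi.
  apply: in2W => -[m n] [m' n'] /= [mm nn em en].
  by rewrite (intEsign m) (intEsign n) mm nn em en -!intEsign.
pose F (u : (bool * bool) * (nat * nat)) : \bar R :=
  (`|a u.2.1 u.2.2| * nu ^+ u.2.1)%:E.
have F0 u : (0 <= F u)%E by rewrite lee_fin mulr_ge0 ?exprn_ge0.
apply: (@le_trans _ _ (\esum_(u in [set: _]) F u)%E).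
  exact: (esum_inj_le F0 phiI).
pose G (x : nat * nat) : \bar R := (`|a x.1 x.2| * nu ^+ x.1)%:E.
have -> : (\esum_(u in [set: _]) F u =
    \esum_(s in [set: bool * bool]) \esum_(x in [set: nat * nat]) G x)%E.
  rewrite esum_esum//; last by move=> i j _ _; exact: (F0 (i, j)).
  rewrite (_ : [set: _] `*`` _ = [set: _])//.
  by apply/seteqP; split.
have GW : (\esum_(x in [set: nat * nat]) G x <= wnorm nu a)%E.
  apply: le_esum => x _; rewrite lee_fin ler_wpM2l//; exact: omega_ge_expr.
rewrite (esum_fset finite_finset); last first.
  by move=> i _; apply: esum_ge0 => x _; exact: (F0 (i, x)).
pose quadrants := [:: (false, false); (false, true); (true, false); (true, true)].
rewrite (_ : [set: bool * bool] = [set` quadrants]); last first.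
  by apply/seteqP; split => -[[] []].
rewrite -fsbig_seq// !big_cons big_nil.
pose w := wnorm nu a; apply: (@le_trans _ _ (w + (w + (w + (w + 0))))%E).
  by do 4 (apply: leeD => //).
rewrite {}/w.
have := wnorm_ge0 nu_ge1 a; case: (wnorm nu a) => [w _| _|//].
  by rewrite -!EFinD -EFinM lee_fin; lra.
by rewrite gt0_muley ?leey.
Qed.

(** Young's inequality for the weighted convolution: [omega] at [x] is at
most four times the product of the group weights at [n] and [x - n], and after
exchanging the two sums, [x |-> x - n] is injective. *)
Lemma wnorm_conv_le_znorm a c : (znorm c < +oo)%E ->
  (wnorm nu (Defs.conv a c) <= 4%:E * (znorm a * znorm c))%E.
Proof.
move=> cy; pose B (x n : int * int) : \bar R :=
  ((`|even_ext a n| * zweight n)%:E *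
   (`|even_ext c (x - n)| * zweight (x - n))%:E)%E.
have B0 x n : (0 <= B x n)%E.
  by rewrite mule_ge0// lee_fin mulr_ge0 ?zweight_ge0.
pose z (x : nat * nat) : int * int := (x.1%:Z, x.2%:Z).
have step1 x : ((`|Defs.conv a c x.1 x.2| * omega nu x.1 x.2)%:E <=
    4%:E * \esum_(n in [set: int * int]) B (z x) n)%E.
  apply: (@le_trans _ _ ((4 * zweight (z x))%:E * \esum_(n in [set: int * int])
      (`|even_ext a n * even_ext c (z x - n)|)%:E)%E).
    rewrite mulrC EFinM; apply: lee_pmul; rewrite ?lee_fin//.
    - exact/ltW/omega_gt0.
    - exact: omega_le_expr.
    - exact: normr_usum_le.
  rewrite EFinM -muleA lee_wpmul2l ?lee_fin//.
  rewrite -esumZl ?zweight_ge0//; apply: le_esum => n _.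
  rewrite -!EFinM lee_fin normrM mulrACA [leRHS]mulrC ler_wpM2r//.
  by rewrite -{1}(subrKC n (z x)) zweight_submul.
apply: (@le_trans _ _ (4%:E * \esum_(x in [set: nat * nat])
    \esum_(n in [set: int * int]) B (z x) n)%E).
  rewrite -esumZl// => [|x]; last by apply: esum_ge0 => n _; exact: B0.
  by apply: le_esum => x _; exact: step1.
rewrite lee_wpmul2l ?lee_fin// esum_swap//.
have zI n : set_inj [set: nat * nat] (fun x => z x - n).
  by apply: in2W => -[x1 x2] [y1 y2] /addIr[-> ->].
apply: (@le_trans _ _ (\esum_(n in [set: int * int])
   ((`|even_ext a n| * zweight n)%:E * znorm c))%E).
  apply: le_esum => n _; rewrite esumZl ?mulr_ge0 ?zweight_ge0//; last first.
    by move=> x; rewrite lee_fin mulr_ge0 ?zweight_ge0.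
  apply: lee_wpmul2l; first by rewrite lee_fin mulr_ge0 ?zweight_ge0.
  apply: (esum_inj_le (f := fun n => (`|even_ext c n| * zweight n)%:E) _ (zI n)).
  by move=> m; rewrite lee_fin mulr_ge0 ?zweight_ge0.
rewrite -(fineK (_ : znorm c \is a fin_num)) ?ge0_fin_numE ?znorm_ge0//.
have s0 : 0 <= fine (znorm c) by rewrite fine_ge0 ?znorm_ge0.
rewrite [leRHS]muleC -esumZl//; last first.
  by move=> n; rewrite lee_fin mulr_ge0 ?zweight_ge0.
by apply: le_esum => n _; rewrite muleC.
Qed.

(** The constant is far from optimal, but any finite constant makes convolution
continuous. *)
Lemma wnorm_conv_le a c : (wnorm nu c < +oo)%E ->
  (wnorm nu (Defs.conv a c) <= 64%:E * (wnorm nu a * wnorm nu c))%E.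
Proof.
move=> cy; apply: le_trans (wnorm_conv_le_znorm a _) _.
  by apply: le_lt_trans (znorm_le c) _; rewrite lte_mul_pinfty.
apply: (@le_trans _ _
    (4%:E * ((4%:E * wnorm nu a) * (4%:E * wnorm nu c)))%E).
  by rewrite lee_wpmul2l ?lee_fin// lee_pmul ?znorm_ge0 ?znorm_le.
by rewrite muleACA -EFinM (muleA 4%:E) -EFinM (_ : 4 * (4 * 4) = 64 :> R)//; ring.
Qed.

Lemma abssum_conv_term_lty a c k j :
  (wnorm nu a < +oo)%E -> (wnorm nu c < +oo)%E ->
  (abssum (fun n : int * int =>
     a `|n.1|%N `|n.2|%N * c `|k%:Z - n.1|%N `|j%:Z - n.2|%N)%R < +oo)%E.
Proof.
move=> ay cy; have ? := wnorm_ge0 nu_ge1 c.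
have fc : wnorm nu c \is a fin_num by rewrite ge0_fin_numE.
apply: (@le_lt_trans _ _ (wnorm nu c * znorm a)%E).
  rewrite -(fineK fc) -esumZl ?fine_ge0//; last first.
    by move=> n; rewrite lee_fin mulr_ge0 ?zweight_ge0.
  apply: le_esum => n _; rewrite -EFinM lee_fin normrM mulrC ler_pM//.
    by rewrite -lee_fin (fineK fc) ler_coef_wnorm.
  by rewrite ler_peMr// exprn_ege1.
rewrite -(fineK fc) lte_mul_pinfty ?lee_fin ?fine_ge0//.
by apply: le_lt_trans (znorm_le a) _; rewrite lte_mul_pinfty.
Qed.

Lemma conv_linearl a a' c l :
  (wnorm nu a < +oo)%E -> (wnorm nu a' < +oo)%E -> (wnorm nu c < +oo)%E ->
  Defs.conv (l *: a + a') c = l *: Defs.conv a c + Defs.conv a' c.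
Proof.
move=> ay a'y cy; apply/funext => k; apply/funext => j.
rewrite -[RHS]/(l * Defs.conv a c k j + Defs.conv a' c k j) /Defs.conv.
have acy := abssum_conv_term_lty k j ay cy.
have a'cy := abssum_conv_term_lty k j a'y cy.
rewrite -(usumZ l acy) -(usumD (abssumZ_lty l acy) a'cy).
by congr usum; apply/funext => n; rewrite mulrA -mulrDl.
Qed.

Lemma conv_linearr a c c' l :
  (wnorm nu a < +oo)%E -> (wnorm nu c < +oo)%E -> (wnorm nu c' < +oo)%E ->
  Defs.conv a (l *: c + c') = l *: Defs.conv a c + Defs.conv a c'.
Proof.
move=> ay cy c'y; apply/funext => k; apply/funext => j.
rewrite -[RHS]/(l * Defs.conv a c k j + Defs.conv a c' k j) /Defs.conv.
have acy := abssum_conv_term_lty k j ay cy.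
have ac'y := abssum_conv_term_lty k j ay c'y.
rewrite -(usumZ l acy) -(usumD (abssumZ_lty l acy) ac'y).
by congr usum; apply/funext => n; rewrite mulrCA -mulrDr.
Qed.

Lemma Lamop_linear a c l : Lamop (l *: a + c) = l *: Lamop a + Lamop c.
Proof.
apply/funext => k; apply/funext => j.
rewrite -[RHS]/(l * Lamop a k j + Lamop c k j).
case: j => [|j]; first by rewrite /= mulr0 addr0.
rewrite -[LHS]/(- (l * a k j + c k j) + (l * a k j.+2 + c k j.+2)) /=.
by ring.
Qed.

(** [Lamop] is a sum of two shifts in the second index. Shifting the index [0] to
the index [1] at most doubles its weight; all other weights are unchanged or
decrease. *)
Lemma wnorm_Lamop_le a : (wnorm nu (Lamop a) <= 3%:E * wnorm nu a)%E.
Proof.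
pose F (x : nat * nat) := (`|a x.1 x.2| * omega nu x.1 x.2)%:E.
pose D := [set x : nat * nat | (0 < x.2)%N].
pose left (x : nat * nat) := (x.1, x.2.-1).
pose right (x : nat * nat) := (x.1, x.2.+1).
have F0 x : (0 <= F x)%E by exact: term_ge0.
have FZ l x : 0 <= l -> (0 <= l%:E * F x)%E by move=> ?; rewrite mule_ge0.
apply: (@le_trans _ _ (\esum_(x in [set: nat * nat])
   ((if x \in D then 2%:E * F (left x) else 0) + F (right x)))%E).
  apply: le_esum => -[k [|j]] _.
    rewrite /= normr0 mul0r; case: ifP => _; rewrite ?add0e ?F0//.
    by rewrite adde_ge0 ?FZ.
  rewrite mem_set// /left /right /F/= -EFinM -EFinD lee_fin.
  apply: (@le_trans _ _ ((`|a k j| + `|a k j.+2|) * omega nu k j.+1)).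
    rewrite ler_wpM2r//; first exact/ltW/omega_gt0.
    by rewrite (le_trans (ler_normD _ _))// normrN.
  rewrite mulrDl mulrCA lerD//.
  rewrite ler_wpM2l//; have := exprn_ge0 k nu_ge0.
  by case: k j => [|k] [|j] /=; lra.
rewrite esumD => [|x _|x _]//; last by case: ifP => // _; rewrite FZ.
rewrite -esum_mkcond esumZl//.
have -> : (3%:E * wnorm nu a = 2%:E * wnorm nu a + wnorm nu a)%E.
  rewrite -[X in (_ + X)%E]mul1e -(@ge0_muleDl _ _ 2%:E)// -EFinD.
  by rewrite (_ : 3 = 2 + 1 :> R)//; ring.
apply: leeD.
  rewrite lee_wpmul2l ?lee_fin//; apply: esum_inj_le => //.
  by move=> [k [|j]] [k' [|j']]; rewrite ?inE// /left/= => _ _ [-> ->].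
by apply: esum_inj_le => //; apply: in2W => -[k j] [k' j'] [-> ->].
Qed.

(** This makes the alternating series in the first entry of [Lop] converge, and
hence [Lop] linear on the space. *)
Lemma abs_cvg_row a k : (wnorm nu a < +oo)%E -> cvgn [normed series (a k)].
Proof.
move=> ay.
have fa : wnorm nu a \is a fin_num by rewrite ge0_fin_numE// wnorm_ge0.
apply: nondecreasing_is_cvgn.
  by apply: nondecreasing_series => i _ _ /=; exact: normr_ge0.
exists (fine (wnorm nu a)) => _ [n _ <-].
rewrite -lee_fin fineK// -sumEFin.
apply: le_trans (nneseries_lim_ge n _) _; first by move=> *; rewrite lee_fin normr_ge0.
rewrite nneseries_esumT => [|i]; last by rewrite lee_fin normr_ge0.
apply: (@le_trans _ _ (\esum_(i in [set: nat]) (`|a (k, i).1 (k, i).2| *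
    omega nu (k, i).1 (k, i).2)%:E)%E).
  apply: le_esum => i _; rewrite lee_fin/= ler_peMr//.
  by rewrite (le_trans _ (omega_ge_expr k i))// exprn_ege1.
apply: (esum_inj_le (f := fun x => (`|a x.1 x.2| * omega nu x.1 x.2)%:E)) => //.
by apply: in2W => i j [].
Qed.

End weighted_l1.

(** * The operators on the weighted space *)

Section space_operators.
Context {R : realType} {nu : R} {nu_ge1 : 1 <= nu}.
Local Notation X := (Xspace nu_ge1).
Implicit Types x y : X.

Lemma EFin_normX x : (`|x|)%:E = wnorm nu x.
Proof. exact: normXE. Qed.

Lemma wnorm_lty x : (wnorm nu x < +oo)%E.
Proof. by have := seqX_summable x; rewrite inE. Qed.

Definition inX (a : nat -> nat -> R) (ay : (wnorm nu a < +oo)%E) : X :=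
  @MkX R nu nu_ge1 a ay.

Lemma seqX_inj : injective (@seqX R nu nu_ge1).
Proof. exact: val_inj. Qed.

Lemma ler_coefX x k j : `|x k j| <= `|x|.
Proof. by rewrite -lee_fin EFin_normX ler_coef_wnorm. Qed.

Lemma convX_subproof x y : (wnorm nu (Defs.conv x y) < +oo)%E.
Proof.
apply: le_lt_trans (wnorm_conv_le nu_ge1 _ (wnorm_lty y)) _.
by rewrite -!EFin_normX -!EFinM ltry.
Qed.

Definition convX x y : X := inX (convX_subproof x y).

Lemma convX_is_bilinear : bilinear_for
  (GRing.Scale.Law.clone _ _ *:%R _) (GRing.Scale.Law.clone _ _ *:%R _) convX.
Proof.
split=> [z l x y|z l x y]; apply: seqX_inj.
- exact: (conv_linearl nu_ge1 _ (wnorm_lty x) (wnorm_lty y) (wnorm_lty z)).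
- exact: (conv_linearr nu_ge1 _ (wnorm_lty z) (wnorm_lty x) (wnorm_lty y)).
Qed.

HB.instance Definition _ := bilinear_isBilinear.Build R X X X _ _ convX
  convX_is_bilinear.

Lemma ler_norm_convX x y : `|convX x y| <= 64 * (`|x| * `|y|).
Proof.
rewrite -lee_fin !EFinM !EFin_normX.
exact: (wnorm_conv_le nu_ge1 _ (wnorm_lty y)).
Qed.

Lemma LamX_subproof x : (wnorm nu (Lamop x) < +oo)%E.
Proof.
apply: le_lt_trans (wnorm_Lamop_le nu_ge1 _) _.
by rewrite -!EFin_normX -!EFinM ltry.
Qed.

Definition LamX x : X := inX (LamX_subproof x).

Lemma LamX_is_linear : linear LamX.
Proof. by move=> l x y; apply: seqX_inj; exact: (Lamop_linear x y l). Qed.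

HB.instance Definition _ := GRing.isLinear.Build R X X *:%R LamX LamX_is_linear.

Lemma ler_norm_LamX x : `|LamX x| <= 3 * `|x|.
Proof. by rewrite -lee_fin EFinM !EFin_normX; exact: wnorm_Lamop_le. Qed.

(** [powX x m] is the convolution power of exponent [m.+1], so that the recursion
starts at [x] rather than at the unit. *)
Definition powX x m : X := iter m (convX x) x.

Lemma seqX_powX x m : seqX (powX x m) = conv_exp x m.+1.
Proof.
rewrite /conv_exp iteropS /powX.
by elim: m => // m IH; rewrite !iterS -IH.
Qed.

Definition QX (p : nat) (q : nat -> R) x : X :=
  \sum_(1 <= m < p) q m.+1 *: powX x m.

Lemma seqX_QX p q x : seqX (QX p q x) = Qop p q x.
Proof.
rewrite /Qop [RHS]big_add1 /QX/=.
rewrite (big_morph (@seqX R nu nu_ge1) (@seqXD _ _ _) (erefl : seqX 0 = 0)).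
by apply: eq_bigr => m _; rewrite seqXZ seqX_powX.
Qed.

Lemma Lop_linear mu x y l : Lop mu (l *: x + y) = l *: Lop mu x + Lop mu y.
Proof.
apply/funext => k; apply/funext => j.
rewrite -[RHS]/(l * Lop mu x k j + Lop mu y k j).
have lin i : (l *: x + y) k i = l * x k i + y k i by [].
case: j => [|j]; last first.
  rewrite -[LHS]/(mu k * (l * x k j + y k j) +
    2 * j.+1%:R * (l * x k j.+1 + y k j.+1) -
    mu k * (l * x k j.+2 + y k j.+2)) /=.
  by ring.
pose S (z : nat -> nat -> R) n : R := \sum_(1 <= i < n) ((-1) ^+ i * z k i).
have cvS (z : X) : cvgn (S z).
  rewrite (@is_cvg_series_restrict 1 R R (fun i => (-1) ^+ i * z k i)).
  apply: normed_cvg; rewrite (_ : [normed series _] = [normed series (z k)]).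
    exact: abs_cvg_row (wnorm_lty z).
  by congr series; apply/funext => i /=; rewrite normrM normrX normrN1 expr1n mul1r.
have limS : limn (S (seqX (l *: x + y))) = l * limn (S x) + limn (S y).
  apply/cvg_lim => //.
  rewrite (_ : S _ = (fun n => l * S x n + S y n)).
    by apply: cvgD; [apply: cvgMr; exact: cvS|exact: cvS].
  apply/funext => n; rewrite /S mulr_sumr -big_split; apply: eq_bigr => i _.
  by rewrite lin mulrDr mulrCA.
rewrite -[LHS]/((l *: x + y) k 0%N + 2 * limn (S (seqX (l *: x + y)))) limS lin.
rewrite -[RHS]/(l * (x k 0%N + 2 * limn (S x)) + (y k 0%N + 2 * limn (S y))).
by ring.
Qed.

Section inverse.
Context {mu : nat -> R} (L_inv : L_invertible nu_ge1 mu).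

Definition LinvX y : X := Linv nu_ge1 mu y.

Lemma Lop_LinvX y : Lop mu (LinvX y) = y.
Proof.
have [x [Lx _]] := L_inv.1 y.
by rewrite /LinvX /Linv; case: xgetP => [z _ //|/(_ x)/(_ Lx)].
Qed.

Lemma Lop_inj x y (z : X) : Lop mu x = z -> Lop mu y = z -> x = y.
Proof. by have [w [_ uw]] := L_inv.1 z => Lx Ly; rewrite -(uw _ Lx) (uw _ Ly). Qed.

Lemma LinvX_is_linear : linear LinvX.
Proof.
move=> l x y; apply: (@Lop_inj _ _ (l *: x + y)); first exact: Lop_LinvX.
by rewrite Lop_linear !Lop_LinvX.
Qed.

End inverse.

Lemma wnorm_embed (b : nat -> R) : wnorm nu (embed b) =
  (`|b 0%N|%:E + 2%:E * \sum_(1 <= k <oo) (`|b k| * nu ^+ k)%:E)%E.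
Proof.
have nu_ge0 : 0 <= nu by exact: le_trans ler01 nu_ge1.
pose F (x : nat * nat) : \bar R :=
  (`|embed b x.1 x.2| * omega nu x.1 x.2)%:E.
have -> : wnorm nu (embed b) =
    (\esum_(k in [set: nat]) \esum_(j in [set: nat]) F (k, j))%E.
  rewrite esum_esum//; last first.
    by move=> k j _ _; rewrite lee_fin mulr_ge0// ltW// omega_gt0.
  rewrite (_ : [set: _] `*`` _ = [set: _]); last by apply/seteqP; split.
  by apply: eq_esum => -[].
transitivity (\esum_(k in [set: nat]) (`|b k| * omega nu k 0)%:E)%E.
  apply: eq_esum => k _.
  transitivity (\esum_(j in [set 0%N]) F (k, j))%E.
    rewrite [RHS]esum_mkcond; apply: eq_esum => j _.
    case: ifPn => //; rewrite notin_setE/= => /eqP j0.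
    by rewrite /F /embed/= (negbTE j0) normr0 mul0r.
  by rewrite esum_set1// lee_fin mulr_ge0// ltW// omega_gt0.
rewrite -nneseries_esumT => [|k]; last first.
  by rewrite lee_fin mulr_ge0// ltW// omega_gt0.
rewrite nneseries_recl => // [|k _]; last first.
  by rewrite lee_fin mulr_ge0// ltW// omega_gt0.
rewrite /= mulr1; congr (_ + _)%E.
rewrite -nneseriesZl//; last by move=> k _; rewrite lee_fin mulr_ge0 ?exprn_ge0.
apply/congr_lim/funext => n; apply: eq_big_nat => -[//|k] _.
by rewrite /= -EFinM mulrCA.
Qed.

End space_operators.

(** * Completeness of the weighted space *)

Section completeness.
Context {R : realType} {nu : R} {nu_ge1 : 1 <= nu}.
Local Notation X := (Xspace nu_ge1).

(** A Fatou lemma: each finite partial sum of the norm passes to the limit. *)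
Lemma wnorm_lim_le (F : set_system X) (FF : ProperFilter F) (x : X)
    (l : nat -> nat -> R) (e : R) :
  (forall k j, (y : X) k j @[y --> F] --> l k j) ->
  (\forall y \near F, `|y - x| <= e) -> (wnorm nu (l - seqX x)%R <= e%:E)%E.
Proof.
move=> yl ye; apply: ge_ereal_sup => _ [A [finA _] <-].
rewrite fsbig_finite//= sumEFin lee_fin.
pose S (y : nat -> nat -> R) := \sum_(s <- finmap.enum_fset (fset_set A))
  (`|y s.1 s.2 - x s.1 s.2| * omega nu s.1 s.2).
have SF : S (y : X) @[y --> F] --> S l.
  apply: cvg_big => [|s _]; first exact: add_continuous.
  apply: cvgMl; apply: cvg_norm; apply: cvgB => //; exact: cvg_cst.
rewrite -[leLHS]/(S l) -(cvg_lim _ SF)//; apply: limr_le.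
  by apply/cvg_ex; exists (S l).
apply: filterS ye => y ye.
rewrite -lee_fin; apply: le_trans (_ : (`|y - x|)%:E <= _)%E; last by rewrite lee_fin.
rewrite EFin_normX -sumEFin -(fsbig_finite _ _ finA).
by apply: ereal_sup_ubound; exists A.
Qed.

Lemma Xspace_complete (F : set_system X) :
  ProperFilter F -> cauchy F -> cvg F.
Proof.
move=> FF /cauchy_ballP Fc.
have coef k j : cvg ((y : X) k j @[y --> F]).
  apply: cauchy_cvg; apply/cauchy_ballP => e e0; rewrite near_map2.
  apply: filterS (Fc e e0) => -[x y]/=; rewrite -!ball_normE/=.
  by apply: le_lt_trans; exact: (ler_coefX (x - y)).
pose l k j := lim ((y : X) k j @[y --> F]).
have near_l (e : R) : 0 < e ->
    \forall x \near F, (wnorm nu (l - seqX x)%R <= e%:E)%E.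
  move=> e0; have [[P Q] /= [FP FQ] PQ] := Fc e e0.
  apply: filterS FP => x Px; apply: (wnorm_lim_le FF) => [k j|]; first exact: coef.
  apply: filterS FQ => y Qy; have := PQ (x, y) (conj Px Qy).
  by rewrite /= -ball_normE/= distrC => /ltW.
have ly : (wnorm nu l < +oo)%E.
  have [x xl] := filter_ex (near_l 1 ltr01).
  have -> : l = seqX x + (l - seqX x) by rewrite addrC subrK.
  apply: le_lt_trans (wnormD nu_ge1 _ _) _.
  exact: lte_add_pinfty (wnorm_lty x) (le_lt_trans xl (ltry _)).
apply/cvg_ex; exists (inX ly); apply/cvgrPdist_le => e e0.
apply: filterS (near_l e e0) => x; rewrite -lee_fin EFin_normX; exact.
Qed.

HB.instance Definition _ := Uniform_isComplete.Build X Xspace_complete.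
End completeness.

(** * The fixed point operator *)

Section newton_operator.
Context {R : realType} {nu : R} {nu_ge1 : 1 <= nu}.
Local Notation X := (Xspace nu_ge1).

Lemma differentiable_powX m (x : X) : differentiable (powX^~ m) x.
Proof.
elim: m => [|m IH]; first exact: ex_diff.
apply: (@differentiable_comp _ _ _ _ (fun y => (y, powX y m))
  (fun z : X * X => convX z.1 z.2)).
  by apply: differentiable_pair => //; exact: ex_diff.
exact: bounded_bilinear_differentiable (@ler_norm_convX _ _ _).
Qed.

Lemma differentiable_QX p q (x : X) : differentiable (QX p q) x.
Proof.
have -> : QX p q = \sum_(1 <= m < p) q m.+1 *: (powX (nu_ge1 := nu_ge1))^~ m.
  by apply/funext => y; rewrite fct_sumE.
elim/big_ind : _ => [|f g df dg|m _]; first exact: differentiable_cst.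
- exact: differentiableD.
- exact/differentiableZ/differentiable_powX.
Qed.

Context {h : R} {mu b : nat -> R} {p : nat} {q : nat -> R}.
Context (L_inv : L_invertible nu_ge1 mu).
Context (b_lty : (wnorm nu (embed b) < +oo)%E).

Definition rhsX (x : X) : X := inX b_lty - (h / 2) *: LamX (QX p q x).

Lemma seqX_rhsX x : seqX (rhsX x) = embed b - (h / 2) *: Lamop (Qop p q x).
Proof. by rewrite -seqX_QX. Qed.

Lemma Top_LinvX : Top h mu b p q = (@LinvX _ _ nu_ge1 mu) \o rhsX.
Proof. by apply/funext => x; rewrite /= /LinvX seqX_rhsX. Qed.

(** [T] is the composite of the polynomial [QX] with bounded affine maps. *)
Lemma differentiable_Top (x : X) :
  differentiable (Top h mu b p q : X -> X) x.
Proof.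
rewrite Top_LinvX; apply: differentiable_comp.
  apply: differentiableB; first exact: differentiable_cst.
  apply: differentiableZ; apply: differentiable_comp.
    exact: differentiable_QX.
  exact: bounded_linear_differentiable (@ler_norm_LamX _ _ _).
have [C LC] := L_inv.2.
pose f : {linear X -> X} :=
  HB.pack (@LinvX _ _ nu_ge1 mu)
    (GRing.isLinear.Build R X X *:%R _ (LinvX_is_linear L_inv)).
exact: (@bounded_linear_differentiable _ _ _ f C _ LC).
Qed.

(** [F x] is [Lop mu x - rhsX x], and [T x] is the only solution [y] of
[Lop mu y = rhsX x]. *)
Lemma Top_fixpointP (x : X) : Top h mu b p q x = x <-> Fop h mu b p q x = 0.
Proof.
rewrite Top_LinvX /= /Fop.
have -> : Lop mu x - embed b + (h / 2) *: Lamop (Qop p q x) =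
    Lop mu x - seqX (rhsX x) by rewrite seqX_rhsX opprB addrA addrAC.
split => [Tx|/eqP]; first by rewrite -{1}Tx Lop_LinvX// subrr.
rewrite subr_eq0 => /eqP Lx.
by apply: (Lop_inj L_inv) Lx; exact: Lop_LinvX.
Qed.

End newton_operator.

Theorem theorem2p1 (R : realType)
  (d : nat) (gamma : nat -> R)
  (lambda_cvg : lambda d gamma k @[k --> \oo] --> -oo)
  (p : nat) (q : nat -> R)
  (h : R) (h_gt0 : 0 < h)
  (nu : R) (nu_ge1 : 1 <= nu)
  (b : nat -> R)
  (b_summable :
    (`|b 0%N|%:E + 2%:E * \sum_(1 <= k <oo) (`|b k| * nu ^+ k)%:E < +oo)%E)
  (mu : nat -> R) (muE : forall k : nat, mu k = - (h / 2) * lambda d gamma k)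
  (L_inv : L_invertible nu_ge1 mu)
  (abar : Xspace nu_ge1) (Y : R) (Z : R -> R)
  (hY : `|Top h mu b p q abar - abar| <= Y)
  (hZ : forall r : R, 0 < r ->
    (ereal_sup [set opnorm ('d (Top h mu b p q) c) |
                  c in [set c : Xspace nu_ge1 | (`|c - abar| <= r)%R]]
      <= (Z r)%:E)%E)
  (r0 : R) (r0_gt0 : 0 < r0)
  (hp : r0 * (Z r0 - 1) + Y < 0) :
  exists! ahat : Xspace nu_ge1,
    `|ahat - abar| <= r0 /\ Fop h mu b p q ahat = 0.
Proof.
have b_lty : (wnorm nu (embed b) < +oo)%E by rewrite wnorm_embed.
have TZ c : `|c - abar| <= r0 ->
    (opnorm ('d (Top h mu b p q) c) <= (Z r0)%:E)%E.
  move=> cr; apply: le_trans (hZ _ r0_gt0); apply: ereal_sup_ubound.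
  by exists c.
have [x [[xr Tx] x_uniq]] := radii_polynomial_fixpoint
  (fun c _ => differentiable_Top L_inv b_lty c) TZ hY r0_gt0 hp.
exists x; split; first by split=> //; exact/(Top_fixpointP L_inv b_lty).
move=> y [yr Fy]; apply: x_uniq; split=> //.
exact/(Top_fixpointP L_inv b_lty).
Qed.
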